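(* Let $\mathcal{P}_n\subset\mathbb{R}^n$ be the convex hull of all parking functions of length $n$. The number of edges ($1$-dimensional faces) of $\mathcal{P}_n$ is equal to $$\frac{n\cdot n!}{2}\left(\frac{1}{1!}+\frac{1}{2!}+\dots+\frac{1}{n!}\right).$$
   Context: Here $n$ is a positive integer. A sequence $\alpha=(a_1,\dots,a_n)$ with $a_i\in\{1,\dots,n\}$ is a parking function of length $n$ if its weakly increasing rearrangement $b_1\le b_2\le\dots\le b_n$ satisfies $b_i\le i$ for all $i\in\{1,\dots,n\}$. A face of a polytope $\mathcal{P}\subset\mathbb{R}^n$ is a set of the form $\mathcal{P}\cap\{x: c\cdot x=d\}$ where $c\in\mathbb{R}^n$, $d\in\mathbb{R}$ are such that $c\cdot x\le d$ for all $x\in\mathcal{P}$. An edge is a face of dimension $1$.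
   Formalization: The formal theorem assumes n ≥ 2: for n = 1 the polytope is a single point with 0 edges, while the stated formula gives 1/2, so the claim fails there. *)

(* Defs.v *)
From HB Require Import structures.
From mathcomp Require Import all_boot all_order all_algebra.
From mathcomp Require Import boolp classical_sets functions cardinality reals.
From mathcomp Require Import convex.

Set Implicit Arguments.
Unset Strict Implicit.
Unset Printing Implicit Defensive.

Import Order.TTheory GRing.Theory Num.Theory.

Local Open Scope classical_set_scope.
Local Open Scope ring_scope.

(* [nth] is 0-based, so b_(i+1) <= i+1 reads [nth 0 b i <= i.+1] *)
Definition parking_function (n : nat) (a : n.-tuple nat) : bool :=
  (all (fun k => 0 < k <= n) a
   && [forall i : 'I_n, nth 0 (sort leq a) i <= i.+1])%N.

Definition parking_point (R : realType) (n : nat) (a : n.-tuple nat) :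
  'rV[R]_n := \row_i (tnth a i)%:R.

Definition convex_hull (R : realType) (n : nat) (A : set 'rV[R]_n) :
  set 'rV[R]_n := smallest (@convex_set R 'rV[R]_n) A.

Definition parking_polytope (R : realType) (n : nat) : set 'rV[R]_n :=
  convex_hull [set parking_point R a | a in [set a : n.-tuple nat |
                                               parking_function a]].

Arguments parking_polytope R n : clear implicits.

Definition dot (R : realType) (n : nat) (c x : 'rV[R]_n) : R :=
  \sum_(i < n) c 0 i * x 0 i.

(* [c] may be zero: [P] itself and the empty set are faces *)
Definition is_face (R : realType) (n : nat) (P F : set 'rV[R]_n) : Prop :=
  exists c : 'rV[R]_n, exists d : R,
    (forall x, P x -> dot c x <= d) /\ F = P `&` [set x | dot c x = d].

Definition affine_subspace (R : realType) (n : nat) (x0 : 'rV[R]_n)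
  (V : {vspace 'rV[R]_n}) : set 'rV[R]_n := [set x | x - x0 \in V].

Definition is_affine (R : realType) (n : nat) (A : set 'rV[R]_n) : Prop :=
  exists x0, exists V, A = affine_subspace x0 V.

Definition affine_hull (R : realType) (n : nat) (A : set 'rV[R]_n) :
  set 'rV[R]_n := smallest (@is_affine R n) A.

(* the empty set has no dimension in this sense *)
Definition has_dim (R : realType) (n : nat) (A : set 'rV[R]_n) (d : nat) :
  Prop :=
  exists x0, exists V, affine_hull A = affine_subspace x0 V /\ \dim V = d.

Definition is_edge (R : realType) (n : nat) (P F : set 'rV[R]_n) : Prop :=
  is_face P F /\ has_dim F 1.

(* Main.v *)
(* The vertices are the rearrangements of (1, ..., 1, k+1, ..., n) with k >= 1
   ones.  At each of them n independent inequalities are tight, and n neighbouring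
   vertices lie on the n rays of the simplicial cone that these inequalities cut
   out.  Hence every edge through a vertex v joins v to exactly one of its n
   neighbours, and counting incident pairs (vertex, edge) gives
   2 #edges = n #vertices = n (n!/1! + ... + n!/n!). *)
Require Import Defs.
From mathcomp Require Import all_boot all_order all_algebra perm zify ring.

Set Implicit Arguments.
Unset Strict Implicit.
Unset Printing Implicit Defensive.

(** * Vertices and their neighbours *)

Section ParkingVertices.
Variable n' : nat.
(** At least two values exist, so [inord 1] in [nbr] really is 1. *)
Let n := n'.+2.
Implicit Types (f g : {ffun 'I_n -> 'I_n}) (i j x : 'I_n) (t : nat).

Definition fiber f v : {set 'I_n} := [set i | f i == v].
Definition zeros f := #|fiber f ord0|.

(* Values are shifted down by one: [f] encodes the point [(f i + 1)_i].  The
   vertices of the parking polytope are the rearrangements of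
   [(1, ..., 1, k+1, ..., n)], that is of [k] values [0] and of [k, ..., n-1]. *)
Definition vertices : {set {ffun 'I_n -> 'I_n}} :=
  [set f | (0 < zeros f)
         && [forall v : 'I_n, (0 < v) ==> (#|fiber f v| == (zeros f <= v))]].

Lemma verticesP f :
  reflect (0 < zeros f /\ forall v : 'I_n, 0 < v -> #|fiber f v| = (zeros f <= v))
          (f \in vertices).
Proof.
rewrite inE; apply: (iffP andP) => -[z0 fz]; split=> //.
  by move=> v v0; have /forallP/(_ v) := fz; rewrite v0 => /eqP.
by apply/forallP => v; apply/implyP => v0; rewrite fz.
Qed.

Lemma zeros_gt0 f : f \in vertices -> 0 < zeros f.
Proof. by case/verticesP. Qed.

Lemma card_fiber f (v : 'I_n) : f \in vertices -> 0 < v ->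
  #|fiber f v| = (zeros f <= v).
Proof. by case/verticesP => _; apply. Qed.

Lemma vertex_inj f i j : f \in vertices -> 0 < f i -> f i = f j -> i = j.
Proof.
move=> fV fi0 fij; have /card_le1_eqP : #|fiber f (f i)| <= 1.
  by rewrite card_fiber// leq_b1.
by apply; rewrite inE ?fij.
Qed.

Lemma zeros_le f i : f \in vertices -> 0 < f i -> zeros f <= f i.
Proof.
move=> fV fi0; have : 0 < #|fiber f (f i)| by apply/card_gt0P; exists i; rewrite inE.
by rewrite card_fiber// lt0b.
Qed.

Lemma vertex_surj f (v : 'I_n) : f \in vertices -> zeros f <= v ->
  exists i, f i = v.
Proof.
move=> fV fv; have v0 : 0 < v := leq_trans (zeros_gt0 fV) fv.
have /card_gt0P[i] : 0 < #|fiber f v| by rewrite card_fiber// fv.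
by rewrite inE => /eqP; exists i.
Qed.

Lemma vertices_fibers f g : (forall v, #|fiber g v| = #|fiber f v|) ->
  f \in vertices -> g \in vertices.
Proof.
move=> gf /verticesP[f0 fv]; apply/verticesP; rewrite /zeros gf.
by split=> // v v0; rewrite gf fv.
Qed.

Definition upd f i v := [ffun x => if x == i then v else f x].

Definition swap f (u v : 'I_n) := [ffun x => tperm u v (f x)].

Lemma card_fiber_upd f i w v :
  #|fiber (upd f i w) v| + (f i == v) = #|fiber f v| + (w == v).
Proof.
rewrite (cardsD1 i) [X in _ = X + _](cardsD1 i) !inE ffunE eqxx.
rewrite (_ : fiber (upd f i w) v :\ i = fiber f v :\ i); last first.
  by apply/setP => x; rewrite !inE ffunE; case: eqP.
by rewrite addnC addnA addnAC.
Qed.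

Lemma card_fiber_swap f u v w : #|fiber f u| = #|fiber f v| ->
  #|fiber (swap f u v) w| = #|fiber f w|.
Proof.
move=> uv; have -> : fiber (swap f u v) w = fiber f (tperm u v w).
  by apply/setP => x; rewrite !inE ffunE (can2_eq (tpermK u v) (tpermK u v)).
by case: tpermP => [->|->|].
Qed.

(** One neighbour per position. A single 0 changes places with the 1, and one of several zeros rises
    to the largest missing value [k - 1]; the least nonzero value [k] drops to 0; a larger value
    changes places with its predecessor. *)
Definition nbr f i :=
  let k := zeros f in
  if f i == ord0 then
    if k == 1 then swap f (inord 0) (inord 1) else upd f i (inord k.-1)
  else if f i == k :> nat then upd f i ord0
  else swap f (inord (f i).-1) (f i).

(** The [inord] values of [nbr] become ordinals known through equations in [nat], which suit
    [lia]. *)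
Inductive nbr_spec f i : {ffun 'I_n -> 'I_n} -> Type :=
| NbrLast (u v : 'I_n) of f i = ord0 & zeros f = 1 & u = 0 :> nat & v = 1 :> nat
    : nbr_spec f i (swap f u v)
| NbrUp (u : 'I_n) of f i = ord0 & 1 < zeros f & u.+1 = zeros f
    : nbr_spec f i (upd f i u)
| NbrDown of f i = zeros f :> nat : nbr_spec f i (upd f i ord0)
| NbrSwap (u : 'I_n) of zeros f < f i & u.+1 = f i
    : nbr_spec f i (swap f u (f i)).

Lemma zeros_max f : zeros f <= n.
Proof. by rewrite -[leqRHS]card_ord max_card. Qed.

Lemma nbrP f i : f \in vertices -> nbr_spec f i (nbr f i).
Proof.
move=> fV; rewrite /nbr; have z0 := zeros_gt0 fV; have zn := zeros_max f.
have fin := ltn_ord (f i).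
case: eqP => [fi0|/eqP fi0].
  case: eqP => [z1|z1]; first by constructor; rewrite ?inordK.
  by constructor; rewrite ?inordK //; lia.
have zf : zeros f <= f i by apply: zeros_le => //; rewrite lt0n.
case: eqP => [|fz]; first by constructor.
by constructor; rewrite ?inordK //; lia.
Qed.

(** Under either alternative both [u] and [v] occur exactly once. *)
Lemma nbr_fibers_swap f (u v w : 'I_n) : f \in vertices ->
  v = u.+1 :> nat -> zeros f <= u \/ u = 0 :> nat /\ zeros f = 1 ->
  #|fiber (swap f u v) w| = #|fiber f w|.
Proof.
move=> fV vu fu; apply: card_fiber_swap.
rewrite [RHS]card_fiber ?vu//; case: fu => [zu|[u0 z1]]; last first.
  by rewrite (_ : u = ord0) -?/(zeros f) ?z1//; exact: val_inj.
by rewrite card_fiber ?zu ?(leq_trans (zeros_gt0 fV) zu)// ltnW.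
Qed.

Lemma nbr_vertices f i : f \in vertices -> nbr f i \in vertices.
Proof.
move=> fV; have z0 := zeros_gt0 fV; case: (nbrP i fV).
- move=> u v fi z1 u0 v1; apply: (vertices_fibers _ fV) => w.
  by apply: nbr_fibers_swap; rewrite ?u0 ?v1//; right.
- move=> u fi z1 uz; have up := card_fiber_upd f i u.
  have u0 : 0 < u by lia.
  have z' : zeros (upd f i u) = u.
    have := up ord0; rewrite -/(zeros f) -/(zeros (upd f i u)) fi eqxx -val_eqE/=; lia.
  apply/verticesP; rewrite z'; split=> // v v0.
  have := up v; rewrite (card_fiber fV v0) fi -!val_eqE/=; lia.
- move=> fi; have up := card_fiber_upd f i ord0.
  have z' : zeros (upd f i ord0) = (zeros f).+1.
    have := up ord0; rewrite -/(zeros f) -/(zeros (upd f i ord0)) eqxx -val_eqE/=; lia.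
  apply/verticesP; rewrite z'; split=> // v v0.
  have := up v; rewrite (card_fiber fV v0) -!val_eqE/=; lia.
- move=> u zf uf; apply: (vertices_fibers _ fV) => w.
  by apply: nbr_fibers_swap; rewrite ?uf//; left; lia.
Qed.

(** * Sums over the positions of the largest values *)

Definition ge f t : {set 'I_n} := [set x | t <= f x].

Lemma card_geS f (t : 'I_n) : #|ge f t| = #|fiber f t| + #|ge f t.+1|.
Proof.
rewrite -cardsUI (_ : _ :&: _ = set0) ?cards0 ?addn0.
  by apply: eq_card => x; rewrite !inE leq_eqVlt eq_sym.
by apply/setP => x; rewrite !inE -val_eqE /=; lia.
Qed.

Lemma ge_max f t : n <= t -> ge f t = set0.
Proof. by move=> tn; apply/setP => x; rewrite !inE leqNgt (leq_trans _ tn). Qed.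

Lemma card_ge_le f t : f \in vertices -> 0 < t -> #|ge f t| <= n - t.
Proof.
move=> fV; move e : (n - t) => d; elim: d t e => [|d IHd] t td t0.
  by rewrite ge_max ?cards0//; lia.
have tn : t < n by lia.
rewrite (card_geS f (Ordinal tn)) card_fiber//=; apply: (@leq_add _ _ 1 d).
  exact: leq_b1.
by apply: IHd => //; lia.
Qed.

Lemma card_ge_eq f t : f \in vertices -> zeros f <= t -> #|ge f t| = n - t.
Proof.
move=> fV; move e : (n - t) => d; elim: d t e => [|d IHd] t td zt.
  by rewrite ge_max ?cards0//; lia.
have tn : t < n by lia.
rewrite (card_geS f (Ordinal tn)) card_fiber//= ?zt; last by have := zeros_gt0 fV; lia.
by rewrite IHd ?add1n//; lia.
Qed.

(** Layer-cake summation: [a i] is the number of [j] with [1 <= j <= a i], and the two sums are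
    exchanged. *)
Lemma sum_layers (S : {set 'I_n}) (a : 'I_n -> nat) : (forall i, a i < n) ->
  \sum_(i in S) a i = \sum_(1 <= j < n) #|[set i in S | j <= a i]|.
Proof.
move=> an; transitivity (\sum_(1 <= j < n) \sum_(i in S) (j <= a i)); last first.
  apply: eq_bigr => j _; rewrite -[RHS]sum1_card.
  rewrite [RHS](eq_bigl (fun i => (i \in S) && (j <= a i))).
    by rewrite [RHS]big_mkcondr; apply: eq_bigr => i _; case: leqP.
  by move=> i; rewrite inE.
rewrite exchange_big; apply: eq_bigr => i _ /=.
rewrite (big_cat_nat (n := (a i).+1))//=.
rewrite [X in _ + X]big_nat_cond [X in _ + X]big1 ?addn0; last first.
  by move=> j; rewrite andbT => /andP[aj _]; rewrite leqNgt aj.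
rewrite big_nat_cond (eq_bigr (fun=> 1)); last first.
  by move=> j; rewrite andbT => /andP[_ aj]; rewrite -ltnS aj.
by rewrite -big_nat_cond sum_nat_const_nat muln1; lia.
Qed.

(** The parking condition without sorting, for values shifted down by one: [b_j <= j] means that at
    most [n - j] original entries exceed [j]. *)
Definition parking_bound (a : 'I_n -> nat) :=
  forall j : nat, 0 < j -> #|[set i | j <= a i]| <= n - j.

Lemma vertex_parking_bound f : f \in vertices -> parking_bound (fun i => f i).
Proof. by move=> fV j; exact: card_ge_le. Qed.

Lemma parking_bound_lt a i : parking_bound a -> a i < n.
Proof.
move=> /(_ n isT); rewrite subnn leqn0 cards_eq0 => /eqP/setP/(_ i).
by rewrite !inE => /negbT; rewrite -ltnNge.
Qed.

(* Among the parking functions, [f] is extremal for the partial sums over the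
   positions of its largest values. *)
Lemma parking_sum_ge f t a : f \in vertices -> parking_bound a ->
  zeros f <= t \/ t = 0 /\ zeros f = 1 ->
  \sum_(i in ge f t) a i <= \sum_(i in ge f t) f i.
Proof.
move=> fV pa ft; rewrite !sum_layers//; last by move=> i; exact: parking_bound_lt.
rewrite big_nat_cond [leqRHS]big_nat_cond; apply: leq_sum => j.
rewrite andbT => /andP[j0 jn].
have -> : [set i in ge f t | j <= f i] = ge f (maxn t j).
  by apply/setP => i; rewrite !inE geq_max.
(* A layer [j <= t] of [f] is all of [ge f t]; a layer above [t] has exactly [n - j] positions, the
   most that [parking_bound] allows. *)
have [jt|tj] := leqP j t.
  by apply: subset_leq_card; apply/subsetP => i; rewrite inE => /andP[].
rewrite card_ge_eq//; last by lia.
apply: leq_trans (pa j j0); apply: subset_leq_card; apply/subsetP => i.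
by rewrite !inE => /andP[].
Qed.

(* A value [1] occurs only when [f] is a permutation; the inequality tight at its
   position is then the bound on the sum over all positions. *)
Definition threshold m := if m == 1 then 0 else m.

Lemma threshold_vertex f i : f \in vertices -> 0 < f i ->
  zeros f <= threshold (f i) \/ threshold (f i) = 0 /\ zeros f = 1.
Proof.
move=> fV fi0; have := zeros_le fV fi0; have := zeros_gt0 fV; rewrite /threshold.
by case: eqP => [->|]; lia.
Qed.

Lemma sum_ge_fibers f g t : (forall v, #|fiber g v| = #|fiber f v|) ->
  \sum_(x in ge g t) g x = \sum_(x in ge f t) f x.
Proof.
have E h : \sum_(x in ge h t) h x = \sum_(v : 'I_n | t <= v) #|fiber h v| * v.
  rewrite (partition_big h (fun v : 'I_n => t <= v)) => [|x]; last by rewrite inE.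
  apply: eq_bigr => v tv; rewrite -sum_nat_const; apply: congr_big => //.
    by move=> x; rewrite !inE; case: eqP => [->|]; rewrite ?tv ?andbF.
  by move=> x; rewrite inE => /andP[_ /eqP->].
by move=> gf; rewrite !E; apply: eq_bigr => v _; rewrite gf.
Qed.

(** As [t <> v], the consecutive values [u] and [v] lie on the same side of [t]; the exchange thus
    keeps the set [ge f t], and [sum_ge_fibers] applies. *)
Lemma sum_ge_swap f (u v : 'I_n) t :
  (forall w, #|fiber (swap f u v) w| = #|fiber f w|) ->
  v = u.+1 :> nat -> t <> v ->
  \sum_(x in ge f t) swap f u v x = \sum_(x in ge f t) f x.
Proof.
move=> sf uv tv; rewrite -(sum_ge_fibers t sf); apply: eq_bigl => x.
by rewrite !inE ffunE; case: tpermP => [->|->|]; lia.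
Qed.

Lemma sum_ge_lt f g t i : t <= f i -> g i < f i ->
  (forall x, t <= f x -> g x <= f x) ->
  \sum_(x in ge f t) g x < \sum_(x in ge f t) f x.
Proof.
move=> ti gi gf; have iS : i \in ge f t by rewrite inE.
rewrite (bigD1 i)//= [ltnRHS](bigD1 i)//= -addSn leq_add//.
by apply: leq_sum => x; rewrite inE => /andP[/gf].
Qed.

(** * Neighbours against tight inequalities *)

Lemma nbr_zero_off f i j : f \in vertices -> i != j -> f i = ord0 ->
  nbr f j i = ord0.
Proof.
move=> fV ij fi; case: (nbrP j fV).
- move=> u v fj z1 _ _; case/eqP: ij.
  have /card_le1_eqP : zeros f <= 1 by rewrite z1.
  by apply; rewrite inE ?fi ?fj.
- by move=> u *; rewrite ffunE (negPf ij).
- by move=> *; rewrite ffunE (negPf ij).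
- move=> u zf uf; rewrite ffunE fi tpermD// -val_eqE/=.
  all: by have := zeros_gt0 fV; lia.
Qed.

Lemma nbr_zero_diag f i : f \in vertices -> f i = ord0 -> 0 < nbr f i i.
Proof.
move=> fV fi; have z0 := zeros_gt0 fV; case: (nbrP i fV).
- move=> u v _ _ u0 v1; rewrite ffunE fi.
  by rewrite (_ : ord0 = u) ?tpermL ?v1//; apply: val_inj; rewrite /= u0.
- by move=> u *; rewrite ffunE eqxx; lia.
- by rewrite fi /=; lia.
- by rewrite fi.
Qed.

(** A move at [j] either changes one value below the threshold or exchanges two consecutive values
    that the threshold does not separate. *)
Lemma nbr_sum_off f i j : f \in vertices -> i != j -> 0 < f i ->
  \sum_(x in ge f (threshold (f i))) nbr f j x =
  \sum_(x in ge f (threshold (f i))) f x.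
Proof.
move=> fV ij fi0; have z0 := zeros_gt0 fV; have zf := zeros_le fV fi0.
have updE w : f j < threshold (f i) ->
    \sum_(x in ge f (threshold (f i))) upd f j w x =
    \sum_(x in ge f (threshold (f i))) f x.
  move=> jt; apply: eq_bigr => x; rewrite inE ffunE; case: eqP => // ->.
  by rewrite leqNgt jt.
case: (nbrP j fV).
- move=> u v fj z1 u0 v1; apply: sum_ge_swap; [|by rewrite u0|].
  + by move=> w; apply: nbr_fibers_swap; rewrite ?u0 ?v1//; right.
  + by rewrite /threshold v1; case: eqP.
- by move=> u fj z1 uz; rewrite updE// fj /threshold; case: eqP => /=; lia.
- move=> fj; have : f i <> f j :> nat.
    by move=> /val_inj /(vertex_inj fV fi0)/eqP; rewrite (negPf ij).
  by move=> fij; rewrite updE// /threshold; case: eqP; lia.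
- move=> u zu uf; apply: sum_ge_swap => //.
  + by move=> w; apply: nbr_fibers_swap; rewrite ?uf//; left; lia.
  + rewrite /threshold; case: eqP => [_|_ fij]; first by lia.
    by case/eqP: ij; exact: (vertex_inj fV fi0 (val_inj fij)).
Qed.

(** The value at [i] drops; in an exchange, the position that gains lies below the threshold,
    outside the sum. *)
Lemma nbr_sum_diag f i : f \in vertices -> 0 < f i ->
  \sum_(x in ge f (threshold (f i))) nbr f i x <
  \sum_(x in ge f (threshold (f i))) f x.
Proof.
move=> fV fi0; have z0 := zeros_gt0 fV.
have ti : threshold (f i) <= f i by rewrite /threshold; case: eqP; lia.
case: (nbrP i fV).
- by move=> u v fi; rewrite fi in fi0.
- by move=> u fi; rewrite fi in fi0.
- move=> fi; apply: (sum_ge_lt ti) => [|x _]; rewrite ffunE ?eqxx//.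
  by case: eqP.
- move=> u zu uf; apply: (sum_ge_lt ti) => [|x]; rewrite ffunE ?tpermR -?uf//.
  by rewrite /threshold; case: tpermP => [->|->|]; case: eqP; lia.
Qed.

(** * Counting the vertices *)

Section CountWithZeros.
Variable k : nat.
Hypothesis k_gt0 : 0 < k.

Implicit Types (h : {ffun 'I_(n - k) -> 'I_n}) (l : 'I_(n - k)).

(** An injection [h] encodes a vertex with [k] zeros: [h l] is the position of the value [k + l]. *)
Definition place h : {ffun 'I_n -> 'I_n} :=
  [ffun i => if [pick l | h l == i] is Some l then inord (k + l) else ord0].

Lemma place_val h l : injective h -> place h (h l) = k + l :> nat.
Proof.
move=> hI; rewrite ffunE; case: pickP => [l' /eqP/hI->|/(_ l)]; last by rewrite eqxx.
by rewrite inordK; have := ltn_ord l; lia.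
Qed.

Lemma place_eq h l i : injective h -> place h i = k + l :> nat -> i = h l.
Proof.
move=> hI; rewrite ffunE; case: pickP => [l' /eqP<-|_] /=; last by lia.
rewrite inordK; last by have := ltn_ord l'; lia.
by move=> /addnI /val_inj ->.
Qed.

Definition injections := [set h : {ffun 'I_(n - k) -> 'I_n} | injectiveb h].

Lemma place_inj : {in injections &, injective place}.
Proof.
move=> h h'; rewrite !inE => /injectiveP hI /injectiveP hI' hh'.
by apply/ffunP => l; apply: (place_eq hI'); rewrite -hh' place_val.
Qed.

Lemma zeros_place h : k <= n -> injective h -> zeros (place h) = k.
Proof.
move=> kn hI; have -> : zeros (place h) = #|~: (h @: setT)|.
  apply: eq_card => i; rewrite !inE -val_eqE; apply/eqP/negP => [i0 /imsetP[l _ il]|hi].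
    by move: i0; rewrite il /= place_val//; lia.
  rewrite ffunE; case: pickP => // l /eqP hl.
  by case: hi; apply/imsetP; exists l.
by rewrite cardsCs setCK card_imset// cardsT !card_ord; lia.
Qed.

Lemma place_vertices : k <= n ->
  [set place h | h in injections] = [set f in vertices | zeros f == k].
Proof.
move=> kn; apply/setP => f; rewrite [RHS]inE; apply/imsetP/andP.
  move=> [h]; rewrite inE => /injectiveP hI ->; rewrite zeros_place//; split=> //.
  apply/verticesP; rewrite zeros_place//; split=> // v v0.
  have [kv|vk] := leqP k v.
    have vkn : v - k < n - k by have := ltn_ord v; lia.
    apply/eqP/cards1P; exists (h (Ordinal vkn)); apply/setP => i; rewrite !inE.
    apply/eqP/eqP => [iv|->]; first by apply: (place_eq hI); rewrite iv /=; lia.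
    by apply: val_inj; rewrite /= place_val//=; lia.
  apply/eqP; rewrite cards_eq0; apply/eqP/setP => i; rewrite !inE; apply/negP => /eqP.
  rewrite ffunE; case: pickP => [l _|_] E; last by rewrite -E in v0.
  by move: vk; rewrite -E inordK; have := ltn_ord l; lia.
move=> [fV /eqP fk].
have /fin_all_exists[h hE] (l : 'I_(n - k)) : exists i, f i = k + l :> nat.
  have vn : k + l < n by have := ltn_ord l; lia.
  have [|i fi] := @vertex_surj f (Ordinal vn) fV; first by rewrite fk leq_addr.
  by exists i; rewrite fi.
pose H := finfun h; have HE l : f (H l) = k + l :> nat by rewrite ffunE.
have HI : injective H by move=> l l' ll; apply/val_inj/(@addnI k); rewrite -!HE ll.
exists H; first by rewrite inE; apply/injectiveP.
apply/ffunP => i; apply: val_inj; rewrite ffunE; case: pickP => [l /eqP <- |Hi].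
  by rewrite -HE inord_val.
have [fi0|fi0] := posnP (f i); first by rewrite /= fi0.
have kf : k <= f i by rewrite -fk zeros_le.
have fkn : f i - k < n - k by have := ltn_ord (f i); lia.
have /eqP[] := Hi (Ordinal fkn); apply: (vertex_inj fV).
  by rewrite HE; lia.
by apply: val_inj; rewrite [LHS]HE /= subnKC.
Qed.

Lemma card_vertices_zeros : k <= n ->
  #|[set f in vertices | zeros f == k]| = n ^_ (n - k).
Proof.
move=> kn; rewrite -place_vertices// card_in_imset; last exact: place_inj.
by rewrite card_inj_ffuns !card_ord.
Qed.

End CountWithZeros.

Lemma card_vertices : #|vertices| = \sum_(1 <= k < n.+1) n ^_ (n - k).
Proof.
rewrite -sum1_card (partition_big (fun f => inord (zeros f) : 'I_n.+1) predT)//=.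
(* Every vertex has a zero, so the class of index 0 is empty. *)
rewrite big_add1 big_mkord big_ord_recl /= big1 ?add0n; last first.
  move=> f /andP[fV /eqP/(congr1 val)]; rewrite /= inordK ?ltnS ?zeros_max// => z0.
  by have := zeros_gt0 fV; rewrite z0.
apply: eq_bigr => k _; rewrite -card_vertices_zeros ?ltn_ord// -sum1_card.
apply: eq_bigl => f; rewrite inE -val_eqE /= inordK ?ltnS ?zeros_max//.
Qed.

End ParkingVertices.

From mathcomp Require Import boolp classical_sets functions cardinality reals.
From mathcomp Require Import interval_inference convex.
Import Order.TTheory GRing.Theory Num.Theory.
Local Open Scope classical_set_scope.
Local Open Scope card_scope.
Local Open Scope ring_scope.

(** * Edges of simple polytopes *)

Section Dot.
Variables (R : realType) (n : nat).
Implicit Types (a b x y : 'rV[R]_n).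

Lemma dotDr a x y : dot a (x + y) = dot a x + dot a y.
Proof. by rewrite -big_split; apply: eq_bigr => i _; rewrite mxE mulrDr. Qed.

Lemma dotZr a k x : dot a (k *: x) = k * dot a x.
Proof. by rewrite mulr_sumr; apply: eq_bigr => i _; rewrite mxE mulrCA. Qed.

Lemma dotBr a x y : dot a (x - y) = dot a x - dot a y.
Proof. by rewrite -scaleN1r dotDr dotZr mulN1r. Qed.

Lemma dot_sumr (I : finType) (r : pred I) a (F : I -> 'rV[R]_n) :
  dot a (\sum_(i | r i) F i) = \sum_(i | r i) dot a (F i).
Proof.
rewrite exchange_big; apply: eq_bigr => i _.
by rewrite summxE mulr_sumr.
Qed.

Lemma dotNl a x : dot (- a) x = - dot a x.
Proof. by rewrite /dot -sumrN; apply: eq_bigr => i _; rewrite mxE mulNr. Qed.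

Lemma dot_suml (I : finType) (r : pred I) x (F : I -> 'rV[R]_n) :
  dot (\sum_(i | r i) F i) x = \sum_(i | r i) dot (F i) x.
Proof.
rewrite exchange_big; apply: eq_bigr => i _.
by rewrite summxE mulr_suml.
Qed.

Lemma convex_hull_dot_le (A : set 'rV[R]_n) a (d : R) :
  (forall x, A x -> dot a x <= d) -> forall x, convex_hull A x -> dot a x <= d.
Proof.
move=> Ad; apply: smallest_sub => // x y t.
rewrite !in_setE /= => xd yd.
rewrite [conv _ _ _]/(_ *: _ + _ *: _) dotDr !dotZr.
have -> : d = t%:num * d + (1 - t%:num) * d by rewrite -mulrDl addrC subrK mul1r.
by rewrite lerD// ler_wpM2l// subr_ge0 le1.
Qed.

(** The matrix of all [dot (f j) (g i)] is diagonal and invertible, so the square matrix [G] has a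
    right inverse, which is also a left inverse; this expands [x] in the rows of [G]. *)
Lemma dual_basis (f g : 'I_n -> 'rV[R]_n) :
  (forall i j, i != j -> dot (f i) (g j) = 0) ->
  (forall i, 0 < dot (f i) (g i)) ->
  forall x, x = \sum_i (dot (f i) x / dot (f i) (g i)) *: g i.
Proof.
move=> f_off f_diag x.
pose G : 'M[R]_n := \matrix_i g i; pose F : 'M[R]_n := (\matrix_i f i)^T.
pose D : 'M[R]_n := diag_mx (\row_i (dot (f i) (g i))^-1).
have GFD : G *m (F *m D) = 1%:M.
  apply/matrixP => i j; rewrite mulmxA mul_mx_diag !mxE.
  have -> : \sum_k G i k * F k j = dot (f j) (g i).
    by apply: eq_bigr => k _; rewrite !mxE mulrC.
  have [->|ij] := eqVneq i j; first by rewrite mulfV// gt_eqF.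
  by rewrite f_off ?mul0r// eq_sym.
rewrite -[LHS]mulmx1 -(mulmx1C GFD) !mulmxA mulmx_sum_row.
apply: eq_bigr => i _; rewrite rowK mul_mx_diag !mxE; congr (_ / _ *: _).
by apply: eq_bigr => k _; rewrite !mxE mulrC.
Qed.

Lemma affine_hull_sub (A : set 'rV[R]_n) x0 (W : {vspace 'rV[R]_n}) :
  A `<=` affine_subspace x0 W -> affine_hull A `<=` affine_subspace x0 W.
Proof. by move=> AW; apply: smallest_sub => //; exists x0, W. Qed.

Lemma affine_subspaceP x0 (W : {vspace 'rV[R]_n}) x y :
  affine_subspace x0 W x -> affine_subspace x0 W y -> x - y \in W.
Proof.
move=> xW yW; have -> : x - y = (x - x0) - (y - x0).
  by rewrite opprB addrA subrK.
exact: memvB.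
Qed.

End Dot.

(* [V] indexes vertices of [P].  At the vertex [v] the functionals [c v i] and
   the directions [pt (nb v i) - pt v] are dual bases up to positive factors, so
   [P] lies in the simplicial cone spanned by these directions. *)
Section SimplePolytope.
Variables (R : realType) (n : nat) (P : set 'rV[R]_n).
Variables (T : finType) (V : {set T}) (pt : T -> 'rV[R]_n).
Variables (nb : T -> 'I_n -> T) (c : T -> 'I_n -> 'rV[R]_n).
Hypothesis pt_inj : {in V &, injective pt}.
Hypothesis ptP : {in V, forall v, P (pt v)}.
Hypothesis nbV : {in V, forall v i, nb v i \in V}.
Hypothesis c_ge0 : {in V, forall v i x, P x -> 0 <= dot (c v i) (x - pt v)}.
Hypothesis c_off : {in V, forall v i j, i != j ->
  dot (c v i) (pt (nb v j) - pt v) = 0}.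
Hypothesis c_diag : {in V, forall v i, 0 < dot (c v i) (pt (nb v i) - pt v)}.

Let g v i := pt (nb v i) - pt v.
(** Coordinates in the cone at [v], scaled so that the neighbour [nb v i] has coordinate 1. *)
Let mu v i x := dot (c v i) (x - pt v) / dot (c v i) (g v i).

Lemma cone_coord v x : v \in V -> x = pt v + \sum_i mu v i x *: g v i.
Proof.
move=> vV; apply/eqP; rewrite addrC -subr_eq; apply/eqP.
by apply: dual_basis => [i j|i]; [exact: c_off|exact: c_diag].
Qed.

Lemma coord_ge0 v i x : v \in V -> P x -> 0 <= mu v i x.
Proof. by move=> vV Px; apply: divr_ge0; [exact: c_ge0|exact/ltW/c_diag]. Qed.

Lemma coord_nb v i j : v \in V -> mu v i (pt (nb v j)) = (i == j)%:R.
Proof.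
move=> vV; rewrite /mu; have [->|ij] := eqVneq i j.
  by rewrite divff// gt_eqF// c_diag.
by rewrite c_off// mul0r.
Qed.

Lemma coord_eq0 v x : v \in V -> (forall i, mu v i x = 0) -> x = pt v.
Proof.
move=> vV x0; rewrite (cone_coord x vV) big1 ?addr0// => i _.
by rewrite x0 scale0r.
Qed.

Lemma dot_coord v a x : v \in V ->
  dot a x = dot a (pt v) + \sum_i mu v i x * dot a (g v i).
Proof.
move=> vV; rewrite {1}(cone_coord x vV) dotDr dot_sumr; congr (_ + _).
by apply: eq_bigr => i _; rewrite dotZr.
Qed.

Lemma g_neq0 v i : v \in V -> g v i != 0.
Proof.
move=> vV; apply/eqP => g0; have := c_diag vV i; rewrite -/(g v i) g0.
by rewrite -(scale0r 0) dotZr mul0r ltxx.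
Qed.

Lemma nb_neq v i : v \in V -> nb v i != v.
Proof. by move=> vV; have := g_neq0 i vV; rewrite subr_eq0; apply: contraNneq => ->. Qed.

Lemma nb_inj v : v \in V -> injective (nb v).
Proof.
move=> vV i j ij; have := coord_nb i j vV; rewrite -ij coord_nb// eqxx.
by case: eqP => // _ /eqP; rewrite oner_eq0.
Qed.

Definition ray_edge v i := P `&` [set x | forall j, j != i -> mu v j x = 0].

Lemma ray_edge_src v i : v \in V -> ray_edge v i (pt v).
Proof.
move=> vV; split=> [|j _]; first exact: ptP.
by rewrite /mu subrr -(scale0r 0) dotZr !mul0r.
Qed.

Lemma ray_edge_tgt v i : v \in V -> ray_edge v i (pt (nb v i)).
Proof.
move=> vV; split=> [|j ji]; first exact/ptP/nbV.
by rewrite coord_nb// (negPf ji).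
Qed.

Lemma ray_edgeE v i x : v \in V -> ray_edge v i x ->
  x - pt v = mu v i x *: g v i.
Proof.
move=> vV [_ x0]; rewrite {1}(cone_coord x vV) addrC addKr (bigD1 i)//=.
by rewrite big1 ?addr0// => j ji; rewrite x0// scale0r.
Qed.

Lemma ray_edge_is_edge v i : v \in V -> is_edge P (ray_edge v i).
Proof.
move=> vV; split.
  (* Each [c v j] is nonnegative on [P] relative to [pt v], so the sum over [j != i] vanishes only
     where every term does. *)
  exists (- \sum_(j | j != i) c v j), (dot (- \sum_(j | j != i) c v j) (pt v)).
  have dotE x : dot (- \sum_(j | j != i) c v j) x <=
      dot (- \sum_(j | j != i) c v j) (pt v) =
      (0 <= \sum_(j | j != i) dot (c v j) (x - pt v)).
    by rewrite -subr_le0 -dotBr dotNl dot_suml oppr_le0.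
  have dotE' x : (dot (- \sum_(j | j != i) c v j) x ==
      dot (- \sum_(j | j != i) c v j) (pt v)) =
      (\sum_(j | j != i) dot (c v j) (x - pt v) == 0).
    by rewrite -subr_eq0 -dotBr dotNl dot_suml oppr_eq0.
  split=> [x Px|]; first by rewrite dotE sumr_ge0// => j _; rewrite c_ge0.
  apply/seteqP; split=> x [Px x0]; split=> //=.
    apply/eqP; rewrite dotE' big1// => j ji.
    have /eqP := x0 _ ji; rewrite mulf_eq0 invr_eq0 => /orP[/eqP//|].
    by rewrite gt_eqF// c_diag.
  move=> j ji; rewrite /mu (_ : dot _ (x - _) = 0) ?mul0r//.
  move/eqP: x0; rewrite dotE' psumr_eq0 => [/allP/(_ j)|k _]; last exact: c_ge0.
  by rewrite mem_index_enum ji => /(_ isT)/eqP.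
exists (pt v), <[g v i]>%VS; split; last by rewrite dim_vline g_neq0.
apply/seteqP; split.
  apply: affine_hull_sub => x xE; rewrite /affine_subspace/=.
  by rewrite (ray_edgeE vV xE) memvZ// memv_line.
(* An affine subspace containing both [pt v] and [pt (nb v i)] contains their line. *)
move=> x /vlineP[k xk] A [[x0 [W ->]] subA]; rewrite /affine_subspace /=.
have vW := subA _ (ray_edge_src i vV); have wW := subA _ (ray_edge_tgt i vV).
have -> : x - x0 = k *: g v i + (pt v - x0) by rewrite -xk addrA subrK.
by rewrite memvD// memvZ// (affine_subspaceP wW vW).
Qed.

(** The functional [a] of the face is maximal at [v], hence nonpositive on every [g v j]; a point of
    [P] is in [F] iff its coordinates vanish along all directions not orthogonal to [a]. Dimension 1
    leaves exactly one orthogonal direction. *)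
Lemma face_vertex_ray_edge F v : is_edge P F -> v \in V -> F (pt v) ->
  exists i, F = ray_edge v i.
Proof.
move=> [[a [d [Pad FE]]] [x0 [W [hullE dimW]]]] vV vF.
have vd : dot a (pt v) = d by move: vF; rewrite FE => -[].
have ag_le0 i : dot a (g v i) <= 0.
  by rewrite dotBr vd subr_le0 Pad//; apply/ptP/nbV.
have FP x : P x -> F x <-> forall j, mu v j x * dot a (g v j) = 0.
  move=> Px; rewrite FE; split=> [[_ /= /eqP]|xj]; last first.
    by split=> //=; rewrite (dot_coord a x vV) vd big1 ?addr0.
  rewrite (dot_coord a x vV) vd -subr_eq0 addrAC subrr add0r -oppr_eq0 -sumrN.
  rewrite psumr_eq0 => [/allP x0j j|k _].
    by have := x0j j; rewrite mem_index_enum oppr_eq0 => /(_ isT)/eqP.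
  by rewrite oppr_ge0 mulr_ge0_le0// coord_ge0.
have nbF i : dot a (g v i) = 0 -> F (pt (nb v i)).
  move=> ai; apply/FP; first exact/ptP/nbV.
  by move=> j; rewrite coord_nb//; case: eqP => [->|]; rewrite ?ai ?mulr0 ?mul0r.
have hullF x : F x -> affine_subspace x0 W x.
  by rewrite -hullE; exact: sub_gen_smallest.
have gW i : dot a (g v i) = 0 -> g v i \in W.
  by move=> ai; apply: (affine_subspaceP (x0 := x0)); apply: hullF => //; exact: nbF.
(* Without an orthogonal direction [F] would be the single point [pt v]. *)
have [[i ai]|a0] := pselect (exists i, dot a (g v i) = 0); last first.
  have F1 : F `<=` affine_subspace (pt v) 0%VS.
    move=> x Fx; have Px : P x by move: Fx; rewrite FE => -[].
    rewrite /affine_subspace/= (@coord_eq0 v x) ?subrr ?mem0v// => i.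
    have /eqP := (FP x Px).1 Fx i; rewrite mulf_eq0 => /orP[/eqP//|/eqP ai].
    by case: a0; exists i.
  have /eqP := dimW; rewrite (_ : W = 0%VS) ?dimv0//.
  apply/eqP; rewrite -subv0; apply/subvP => w wW.
  have hull0 := affine_hull_sub F1.
  have : affine_hull F (pt v + w).
    rewrite hullE /affine_subspace/= addrAC memvD//.
    by have := hullF _ vF.
  by move=> /hull0; rewrite /affine_subspace/= addrAC subrr add0r.
have WE : W = <[g v i]>%VS.
  apply/esym/eqP; rewrite eqEdim -memvE gW//= dimW dim_vline g_neq0//.
(* A second orthogonal direction [g v j] would be a multiple of [g v i], on which [c v j]
   vanishes. *)
have aj j : j != i -> dot a (g v j) != 0.
  move=> ji; apply/eqP => /gW; rewrite WE => /vlineP[k gk].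
  have := c_diag vV j; rewrite -/(g v j) gk dotZr c_off// mulr0 ltxx//.
exists i; apply/seteqP; split=> x Fx; last first.
  case: Fx => Px xj; apply/FP => // j; have [->|ji] := eqVneq j i.
    by rewrite ai mulr0.
  by rewrite xj// mul0r.
have Px : P x by move: Fx; rewrite FE => -[].
split=> // j ji; have /eqP := (FP x Px).1 Fx j.
by rewrite mulf_eq0 (negPf (aj _ ji)) orbF => /eqP.
Qed.

(** Let [v] maximize [a] over [V]. No neighbour does better, so [a] is nonpositive on the directions
    of the cone at [v], and [pt v] is a maximum over all of [P]. *)
Lemma edge_has_vertex F v0 : v0 \in V -> is_edge P F ->
  exists2 v, v \in V & F (pt v).
Proof.
move=> v0V [[a [d [Pad FE]]] [x0 [W [hullE dimW]]]].
case: (arg_maxP (fun v => dot a (pt v)) v0V) => v vV vmax.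
have {}vmax u : u \in V -> dot a (pt u) <= dot a (pt v) := vmax u.
exists v => //; rewrite FE; split; first exact: ptP.
(* The hull of an empty [F] would lie in the single point [x0 + vpick W]; as it contains [x0], this
   forces [W = 0]. *)
have [x Fx] : exists x, F x.
  apply: contrapT => /forallNP F0.
  have W0 : vpick W == 0.
    have : affine_hull F x0 by rewrite hullE /affine_subspace/= subrr mem0v.
    have F0' : F `<=` affine_subspace (x0 + vpick W) 0%VS by move=> x /F0.
    move=> /(affine_hull_sub F0'); rewrite /affine_subspace/=.
    by rewrite opprD addNKr memv0 oppr_eq0.
  by move: dimW; rewrite (eqP (_ : W == 0%VS)) ?dimv0// -vpick0.
move: Fx; rewrite FE => -[Px /= xd]; apply/eqP; rewrite eq_le Pad/=; last exact: ptP.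
rewrite -xd [leLHS](dot_coord a x vV) gerDl sumr_le0// => i _.
by rewrite mulr_ge0_le0 ?coord_ge0// dotBr subr_le0 vmax// nbV.
Qed.

(** The cone coordinates of [x] and [y] at [v] have opposite signs, yet all are nonnegative. *)
Lemma vertex_extremal v x y r : v \in V -> P x -> P y -> 0 < r ->
  x - pt v = - r *: (y - pt v) -> y = pt v.
Proof.
move=> vV Px Py r0 xy; apply: (coord_eq0 vV) => i; apply/eqP.
rewrite eq_le coord_ge0// andbT -(pmulr_rle0 _ r0) -oppr_ge0 -mulNr.
have -> : - r * mu v i y = mu v i x by rewrite /mu xy dotZr mulrA.
exact: coord_ge0.
Qed.

(** On the ray [v] sits at 0, [nb v i] at 1 and [u] at [s]. [vertex_extremal] is applied at the
    middle point, [u] if [s < 1] and [nb v i] if [s > 1]; the factor is the ratio of the distances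
    to it. *)
Lemma ray_edge_vertices v i u : v \in V -> u \in V -> ray_edge v i (pt u) ->
  u = v \/ u = nb v i.
Proof.
move=> vV uV uE; have [->|uv] := eqVneq u v; [by left|right].
have eq_uv := ray_edgeE vV uE; set s := mu _ _ _ in eq_uv.
have s_ge0 : 0 <= s by apply: coord_ge0 => //; exact: ptP.
have wV := nbV vV i.
have s_gt0 : 0 < s.
  rewrite lt_neqAle s_ge0 andbT; apply: contraNneq uv => s0.
  by apply/eqP/pt_inj => //; apply/eqP; rewrite -subr_eq0 eq_uv -s0 scale0r.
apply: pt_inj => //; apply/eqP; rewrite eq_sym; case: (ltgtP s 1) => [s1|s1|s1].
- apply/eqP/(@vertex_extremal u (pt v) _ (s / (1 - s))) => //; try exact: ptP.
    by rewrite divr_gt0// subr_gt0.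
  have -> : pt (nb v i) - pt u = (1 - s) *: g v i.
    by rewrite scalerBl scale1r -eq_uv opprB addrA subrK.
  by rewrite -opprB eq_uv scalerA mulNr divfK ?scaleNr// subr_eq0 gt_eqF.
- rewrite eq_sym; apply/eqP.
  apply: (@vertex_extremal (nb v i) (pt v) _ (s - 1)^-1) => //; try exact: ptP.
    by rewrite invr_gt0 subr_gt0.
  have -> : pt u - pt (nb v i) = (s - 1) *: g v i.
    by rewrite scalerBl scale1r -eq_uv opprB addrA subrK.
  by rewrite scalerA mulNr mulVf ?scaleN1r ?opprB// subr_eq0 gt_eqF.
- by move: eq_uv; rewrite s1 scale1r => /addIr ->.
Qed.

(** * Edges as pairs of vertices *)

Definition edge_vertices F := [set u in V | `[< F (pt u) >]].

Lemma mem_edge_vertices F u :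
  (u \in edge_vertices F) = (u \in V) && `[< F (pt u) >].
Proof. by rewrite inE. Qed.

Lemma edge_vertices_ray v i : v \in V ->
  edge_vertices (ray_edge v i) = [set v; nb v i]%SET.
Proof.
move=> vV; apply/setP => u; rewrite mem_edge_vertices in_set2.
apply/andP/orP => [[uV /asboolP uE]|[|]/eqP->].
- by have [->|->] := ray_edge_vertices vV uV uE; rewrite eqxx; [left|right].
- by split=> //; apply/asboolP/ray_edge_src.
- by split; [exact: nbV|apply/asboolP/ray_edge_tgt].
Qed.

(** Two edges with the same vertices are rays from a common [v], and the other endpoint determines
    the ray. *)
Lemma edge_vertices_inj v0 : v0 \in V ->
  {in [set F | is_edge P F] &, injective edge_vertices}.
Proof.
move=> v0V F F'; rewrite !in_setE => FE FE' eqFF'.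
have [v vV vF] := edge_has_vertex v0V FE.
have vF' : F' (pt v).
  have : v \in edge_vertices F by rewrite mem_edge_vertices vV; apply/asboolP.
  by rewrite eqFF' mem_edge_vertices => /andP[_ /asboolP].
have [i Fi] := face_vertex_ray_edge FE vV vF.
have [j Fj] := face_vertex_ray_edge FE' vV vF'.
suff -> : F = F' by []. rewrite Fi Fj; congr ray_edge.
apply: (nb_inj vV); have : nb v i \in [set v; nb v j]%SET.
  by rewrite -edge_vertices_ray// -Fj -eqFF' Fi edge_vertices_ray// !inE eqxx orbT.
by rewrite !inE (negPf (nb_neq i vV)) => /eqP.
Qed.

Definition edge_pairs : {set {set T}} :=
  [set [set v; nb v i]%SET | v in V, i in 'I_n]%SET.

Lemma edge_pairsP v0 : v0 \in V ->
  edge_vertices @` [set F | is_edge P F] = [set` edge_pairs].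
Proof.
move=> v0V; apply/seteqP; split=> [_ [F FE <-]|e].
  have [v vV vF] := edge_has_vertex v0V FE.
  have [i ->] := face_vertex_ray_edge FE vV vF.
  by rewrite edge_vertices_ray//; apply/imset2P; exists v i.
case/imset2P => v i vV _ ->; exists (ray_edge v i).
  exact: ray_edge_is_edge.
exact: edge_vertices_ray.
Qed.

(** Double counting of the incidences between vertices and pairs. *)
Lemma card_edge_pairs : (2 * #|edge_pairs| = n * #|V|)%N.
Proof.
have e2 e : e \in edge_pairs -> (\sum_(v in V | v \in e) 1 = 2)%N.
  case/imset2P => v i vV _ ->; rewrite sum1dep_card.
  transitivity #|[set v; nb v i]%SET|; last by rewrite cards2 eq_sym nb_neq.
  apply: eq_card => u; rewrite !inE; apply: andb_idl.
  by move=> /orP[]/eqP -> //; exact: nbV.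
have vn v : v \in V -> (\sum_(e in edge_pairs | v \in e) 1 = n)%N.
  move=> vV; rewrite sum1dep_card.
  have injv : injective (fun i => [set v; nb v i]%SET).
    move=> i j /setP/(_ (nb v i)); rewrite !inE eqxx orbT (negPf (nb_neq i vV)).
    by move=> /esym/eqP/(nb_inj vV).
  rewrite -[RHS]card_ord -cardsT -(card_imset _ injv).
  apply: eq_card => e; rewrite inE; apply/andP/imsetP => [[]|[i _ ->]].
    (* A pair built at [u] and containing [v] is the vertex set of an edge through [v], so it is
       also built at [v]. *)
    case/imset2P => u i uV _ ->; rewrite -(edge_vertices_ray i uV).
    rewrite mem_edge_vertices => /andP[_ /asboolP uE].
    have [j ->] := face_vertex_ray_edge (ray_edge_is_edge i uV) vV uE.
    by exists j => //; exact: edge_vertices_ray.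
  by split; [apply/imset2P; exists v i|rewrite !inE eqxx].
rewrite mulnC -sum_nat_const -(eq_bigr _ e2) (exchange_big_dep (mem V))/=.
  rewrite mulnC -sum_nat_const; apply: eq_bigr => v vV; rewrite -[RHS](vn v vV).
  by apply: eq_bigl => e; rewrite [v \in V]vV.
by move=> e v _ /andP[].
Qed.

Lemma card_edges v0 : v0 \in V -> [set F | is_edge P F] #= `I_#|edge_pairs|.
Proof.
move=> v0V.
apply: card_eq_trans (card_esym (inj_card_eq (edge_vertices_inj v0V))) _.
rewrite (edge_pairsP v0V).
have -> : [set` edge_pairs] = (@enum_val _ (mem edge_pairs)) @` [set: 'I_#|edge_pairs|].
  apply/seteqP; split=> [e eE|_ [k _ <-]]; last exact: enum_valP.
  by exists (enum_rank_in eE e) => //; rewrite enum_rankK_in.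
apply: card_eq_trans (inj_card_eq _) (card_esym card_II).
by move=> i j _ _; exact: enum_val_inj.
Qed.

End SimplePolytope.

(** * The parking polytope *)

Section ParkingPolytope.
Variables (R : realType) (n' : nat).
Let n := n'.+2.
Implicit Types (f : {ffun 'I_n -> 'I_n}) (i j : 'I_n).

Definition shifted_point (a : 'I_n -> nat) : 'rV[R]_n := \row_i (a i).+1%:R.

Definition vertex_point f := shifted_point (fun i => f i).

(** The signs make it nonnegative on the polytope relative to [vertex_point f]. At a value 1, the
    bound on the sum over [ge f 1] would follow from the bound on the total sum and the lower bound
    at the zero, hence the threshold 0. *)
Definition tight_functional f i : 'rV[R]_n :=
  if f i == ord0 then delta_mx 0 i
  else - \sum_(x in ge f (threshold (f i))) delta_mx 0 x.

Lemma dot_delta i (y : 'rV[R]_n) : dot (delta_mx 0 i) y = y 0 i.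
Proof.
rewrite /dot (bigD1 i)//= !mxE !eqxx mul1r big1 ?addr0// => j ji.
by rewrite !mxE (negPf ji) andbF mul0r.
Qed.

Lemma dot_tight f i (a b : 'I_n -> nat) :
  dot (tight_functional f i) (shifted_point a - shifted_point b) =
  if f i == ord0 then (a i)%:R - (b i)%:R
  else (\sum_(x in ge f (threshold (f i))) b x)%:R
       - (\sum_(x in ge f (threshold (f i))) a x)%:R.
Proof.
have subE x : (shifted_point a - shifted_point b) 0 x = (a x)%:R - (b x)%:R.
  by rewrite !mxE !mulrSr; ring.
rewrite /tight_functional; case: ifP => _; first by rewrite dot_delta subE.
rewrite dotNl dot_suml (eq_bigr _ (fun x _ => dot_delta x _)).
by rewrite (eq_bigr _ (fun x _ => subE x)) sumrB opprB !natr_sum.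
Qed.

Lemma vertex_point_inj : injective vertex_point.
Proof.
move=> f g /matrixP fg; apply/ffunP => i; apply/val_inj/eqP.
by have /eqP := fg 0 i; rewrite !mxE eqr_nat eqSS.
Qed.

Lemma parking_bound_tight f i (a : 'I_n -> nat) :
  f \in vertices n' -> parking_bound a ->
  0 <= dot (tight_functional f i) (shifted_point a - vertex_point f).
Proof.
move=> fV pa; rewrite dot_tight; case: eqP => [->|/eqP fi].
  by rewrite subr_ge0 ler_nat.
have fi0 : (0 < f i)%N by rewrite lt0n.
rewrite subr_ge0 ler_nat; apply: parking_sum_ge => //; exact: threshold_vertex.
Qed.

Lemma card_tnth (p : pred nat) (a : n.-tuple nat) :
  #|[set i | p (tnth a i)]%SET| = count p a.
Proof.
by rewrite -sum1_count big_tuple -sum1dep_card.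
Qed.

(** The first [j] sorted entries are at most [j], so those exceeding [j] are among the other
    [n - j]. *)
Lemma parking_function_bound (a : n.-tuple nat) : parking_function a ->
  parking_bound (fun i => (tnth a i).-1).
Proof.
case/andP => /allP a_range /forallP a_sorted j j0.
rewrite (_ : [set i | _]%SET = [set i | (fun m => j < m)%N (tnth a i)]%SET); last first.
  by apply/setP => i; rewrite !inE; lia.
rewrite (card_tnth (fun m => j < m)%N).
have [nj|jn] := leqP n j.
  by rewrite (eqP nj) leqNgt -has_count; apply/negP => /hasP[m /a_range]; lia.
have s_size : size (sort leq a) = n by rewrite size_sort size_tuple.
rewrite -(count_sort leq) -[sort leq a](cat_take_drop j) count_cat.
rewrite (_ : count _ (take j _) = 0)%N; last first.
  apply/eqP; rewrite -leqn0 leqNgt -has_count -all_predC.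
  apply/(all_nthP 0%N) => i; rewrite size_take s_size jn => ij.
  have iN : (i < n)%N by lia.
  by have := a_sorted (Ordinal iN); rewrite /= nth_take//; lia.
by rewrite add0n (leq_trans (count_size _ _))// size_drop s_size.
Qed.

(** If the sorted entry of index [i] exceeded [i + 1], so would all [n - i] entries from there on,
    but [vertex_parking_bound] allows only [n - (i + 1)]. *)
Lemma vertex_parking_function f : f \in vertices n' ->
  parking_function [tuple (f i).+1 | i < n].
Proof.
move=> fV; apply/andP; split.
  by apply/allP => m /mapP[i _ ->]; exact: ltn_ord.
apply/forallP => i; set s := sort _ _; rewrite leqNgt; apply/negP => si.
have s_size : size s = n by rewrite size_sort size_tuple.
have s_sorted : sorted leq s by apply: sort_sorted; exact: leq_total.
have : (size (drop i s) <= count (fun m => i.+1 < m)%N s)%N.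
  rewrite -[X in (_ <= count _ X)%N](cat_take_drop i) count_cat.
  apply: leq_trans (leq_addl _ _).
  rewrite (_ : count _ (drop i s) = size (drop i s)) ?leqnn//.
  apply/eqP; rewrite -all_count; apply/(all_nthP 0%N) => j.
  rewrite size_drop nth_drop => ij; apply: leq_trans si _.
  apply: (sorted_leq_nth leq_trans leqnn 0%N s_sorted).
  all: rewrite ?inE ?s_size ?leq_addr//.
  by rewrite s_size in ij; lia.
rewrite size_drop s_size count_sort -card_tnth leqNgt => /negP[].
have i_lt : (n - i.+1 < n - i)%N by have := ltn_ord i; lia.
apply: leq_ltn_trans i_lt; apply: leq_trans (vertex_parking_bound fV (ltn0Sn i)).
by apply/eq_leq/eq_card => x; rewrite !inE tnth_mktuple.
Qed.

End ParkingPolytope.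

Theorem theorem2p1 (R : realType) (n : nat) (hn : (2 <= n)%N) :
  exists N : nat,
    [set F | is_edge (parking_polytope R n) F] #= `I_N /\
    N%:R = n%:R * n`!%:R / 2 * \sum_(1 <= k < n.+1) (k`!%:R)^-1 :> rat.
Proof.
(* At length 1 the polytope is a point, while the formula gives 1/2. *)
case: n hn => [|[|n']]// _; set n := n'.+2.
have [v0 v0V] : exists v0, v0 \in vertices n'.
  (* The summand for [k = 1] is already positive. *)
  apply/card_gt0P; rewrite card_vertices big_add1 big_mkord (bigD1 ord0)//=.
  by rewrite ltn_addr// ffact_gt0; lia.
have ptP : {in vertices n', forall f, parking_polytope R n (vertex_point R f)}.
  move=> f fV; apply: sub_gen_smallest; exists [tuple (f i).+1 | i < n].
    exact: vertex_parking_function.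
  by apply/rowP => i; rewrite !mxE tnth_mktuple.
have c_ge0 : {in vertices n', forall f i x, parking_polytope R n x ->
    0 <= dot (tight_functional R f i) (x - vertex_point R f)}.
  (* Negation gives an upper bound, which passes from the parking points to their hull. *)
  move=> f fV i x Px; rewrite dotBr subr_ge0 -lerN2 -!dotNl; move: x Px.
  apply: convex_hull_dot_le => _ [a pa <-].
  rewrite !dotNl lerN2 -subr_ge0 -dotBr.
  have -> : parking_point R a = shifted_point R (fun i => (tnth a i).-1).
    apply/rowP => l; rewrite !mxE prednK//.
    by case/andP: pa => /allP/(_ _ (mem_tnth l a))/andP[].
  exact/parking_bound_tight/parking_function_bound.
have c_off : {in vertices n', forall f i j, i != j -> dot (tight_functional R f i)
    (vertex_point R (nbr f j) - vertex_point R f) = 0}.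
  move=> f fV i j ij; rewrite dot_tight; case: eqP => [fi|/eqP fi].
    by rewrite nbr_zero_off// fi subrr.
  by rewrite nbr_sum_off ?subrr// lt0n.
have c_diag : {in vertices n', forall f i, 0 < dot (tight_functional R f i)
    (vertex_point R (nbr f i) - vertex_point R f)}.
  move=> f fV i; rewrite dot_tight; case: eqP => [fi|/eqP fi].
    by rewrite subr_gt0 ltr_nat fi nbr_zero_diag.
  by rewrite subr_gt0 ltr_nat nbr_sum_diag// lt0n.
have nbV : {in vertices n', forall f i, nbr f i \in vertices n'}.
  by move=> f fV i; exact: nbr_vertices.
have ptI : {in vertices n' &, injective (@vertex_point R n')}.
  by move=> f g _ _; exact: vertex_point_inj.
exists #|edge_pairs (vertices n') (@nbr n')|; split.
  exact: (card_edges ptI ptP nbV c_ge0 c_off c_diag v0V).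
have := card_edge_pairs ptI ptP nbV c_ge0 c_off c_diag.
rewrite card_vertices => /(congr1 (fun m => m%:R : rat)) E.
rewrite !natrM natr_sum in E; apply: (mulfI (_ : 2 != 0)) => //.
have half (x y z : rat) : 2 * (x * y / 2 * z) = x * (y * z) by field.
rewrite E half; congr (_ * _).
rewrite mulr_sumr big_nat_cond [RHS]big_nat_cond; apply: eq_bigr => k.
rewrite andbT ltnS => /andP[k1 kn].
(* Here [n ^_ (n - k)] times [k!] is [n!]. *)
by rewrite -(ffact_fact (leq_subr k n)) subKn// natrM mulfK.
Qed.
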